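(* Let $p$ be a prime, $h\ge 1$ an integer, $q=p^h$, and $k$ an integer with $1\le k\le q$. Let $\mathbf{H}_{q,k}$ be the $k\times(q+1)$ supplemented Pascal matrix over $\mathbb{F}_q$ (defined in the context). Then any $k$ distinct columns of $\mathbf{H}_{q,k}$ are linearly independent over $\mathbb{F}_q$.
   Context: Realize $\mathbb{F}_q$ as $\mathbb{F}_p[x]/(g(x))$ for an irreducible polynomial $g$ of degree $h$, so each element is uniquely represented as a polynomial $\sum_{i=0}^{h-1}\beta_i x^i$ with $\beta_i\in\{0,1,\dots,p-1\}$. For an integer $n\in[0,q-1]$, let $\sigma(n)$ be the element of $\mathbb{F}_q$ whose coefficients satisfy $\sum_{i=0}^{h-1}\beta_i p^i=n$ (so $\sigma$ is a bijection from $\{0,\dots,q-1\}$ to $\mathbb{F}_q$ with $\sigma(0)=0$, $\sigma(1)=1$). For integers $m,n\in[0,q-1]$ define $f_0(n)=1$ and, for $m>0$, $f_m(n)=\prod_{i=1}^{m}\frac{\sigma(n)-\sigma(i-1)}{\sigma(i)}$ (computed in $\mathbb{F}_q$). The Pascal matrix $\mathbf{P}_q$ is the $q\times q$ matrix over $\mathbb{F}_q$ with entries $\mathbf{P}_q(m,n)=f_m(n)$, $m,n\in\{0,\dots,q-1\}$ (rows and columns indexed from $0$). The truncated Pascal matrix $\mathbf{P}_{q,k}$ consists of the first $k$ rows of $\mathbf{P}_q$ (a $k\times q$ matrix). The supplemented Pascal matrix $\mathbf{H}_{q,k}$ is the $k\times(q+1)$ matrix obtained by appending to $\mathbf{P}_{q,k}$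 one further column whose last entry is $1$ and all other entries are $0$. *)

(* Defs.v *)
From HB Require Import structures.
From mathcomp Require Import all_boot all_order all_algebra all_field.

Set Implicit Arguments.
Unset Strict Implicit.
Unset Printing Implicit Defensive.

Import GRing.Theory.
Local Open Scope ring_scope.

(* {poly %/ g} is only the expected quotient when g is monic, so an arbitrary
   irreducible g is replaced by its monic associate, which generates the same
   ideal. *)
Definition monic_assoc (F : fieldType) (g : {poly F}) : {poly F} :=
  (lead_coef g)^-1 *: g.

Lemma size_monic_assoc (F : fieldType) (g : {poly F}) :
  irreducible_poly g -> size (monic_assoc g) = size g.
Proof.
case=> g_gt1 _; apply: size_scale.
by rewrite invr_eq0 lead_coef_eq0 -size_poly_gt0 ltnW.
Qed.

Lemma monic_assoc_eqp (F : fieldType) (g : {poly F}) :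
  irreducible_poly g -> monic_assoc g %= g.
Proof.
case=> g_gt1 _; apply: eqp_scale.
by rewrite invr_eq0 lead_coef_eq0 -size_poly_gt0 ltnW.
Qed.

Lemma monic_assocP (F : fieldType) (g : {poly F}) :
  irreducible_poly g -> monic_irreducible_poly (monic_assoc g).
Proof.
move=> gI; split; last first.
  rewrite monicE lead_coefZ mulVf // lead_coef_eq0 -size_poly_gt0.
  by rewrite ltnW //; case: gI.
have gE := monic_assoc_eqp gI; split; first by rewrite size_monic_assoc; case: gI.
by move=> d d1; rewrite (eqp_dvdr _ gE) (eqp_rtrans gE); case: gI => _; apply.
Qed.

Section PascalMatrix.

Variables (p h : nat) (g : {poly 'F_p}) (gI : irreducible_poly g).

Definition Fq : finFieldType := {poly %/ monic_assoc g with monic_assocP gI}.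

(* The element of F_q whose coefficients are the base p digits of n; it is
   characterised by [sum_sigma] and [sigma_bij] below. *)
Definition sigma (n : nat) : Fq :=
  in_qpoly (monic_assoc g) (\poly_(i < h) (n %/ p ^ i %% p)%:R).

Definition pascal_coef (m n : nat) : Fq :=
  \prod_(1 <= i < m.+1) ((sigma n - sigma i.-1) / sigma i).

Definition pascal_mx : 'M[Fq]_(p ^ h) := \matrix_(m, n) pascal_coef m n.

Definition trunc_pascal_mx (k : nat) (kq : (k <= p ^ h)%N) :
    'M[Fq]_(k, p ^ h) :=
  rowsub (widen_ord kq) pascal_mx.

Definition supp_pascal_mx (k : nat) (kq : (k <= p ^ h)%N) :
    'M[Fq]_(k, p ^ h + 1) :=
  row_mx (trunc_pascal_mx kq) (\col_(i < k) (i == k.-1 :> nat)%:R).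

Hypotheses (p_pr : prime p) (sz_g : size g = h.+1).

Lemma sigma_poly (n : nat) :
  (sigma n : {poly %/ monic_assoc g})
    = \poly_(i < h) (n %/ p ^ i %% p)%:R :> {poly 'F_p}.
Proof.
apply: in_qpoly_small; rewrite (mk_monicE (monic_assocP gI)).
by rewrite size_monic_assoc // sz_g ltnS size_poly.
Qed.

Lemma sum_sigma (n : nat) : (n < p ^ h)%N ->
  (\sum_(i < h) ((sigma n : {poly %/ monic_assoc g})`_i)%R * p ^ i)%N = n.
Proof.
move=> n_lt.
transitivity (\sum_(i < h) (n %/ p ^ i %% p) * p ^ i)%N.
  apply: eq_bigr => i _.
  by rewrite sigma_poly coef_poly ltn_ord val_Fp_nat // modn_mod.
elim: (h) n n_lt => [|h' IH] n n_lt.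
  by rewrite big_ord0; case: n n_lt.
rewrite big_ord_recl expn0 divn1 muln1 [RHS](divn_eq n p) addnC; congr addn.
rewrite -[in RHS](IH (n %/ p)%N); last by rewrite ltn_divLR ?prime_gt0 // -expnSr.
rewrite big_distrl /=; apply: eq_bigr => i _.
by rewrite /bump /= add1n expnS divnMA -mulnA [(p * _)%N]mulnC.
Qed.

Lemma sigma_bij : bijective (fun n : 'I_(p ^ h) => sigma n).
Proof.
apply: inj_card_bij => [m n mn|].
  by apply/val_inj; rewrite /= -[LHS]sum_sigma // mn sum_sigma.
rewrite card_ord; change #|Fq| with #|{poly %/ monic_assoc g}|.
by rewrite card_qpoly (mk_monicE (monic_assocP gI)) size_monic_assoc // sz_g card_Fp.
Qed.

End PascalMatrix.

(* Main.v *)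
(** The entry [f_m(n)] is the value at [sigma n] of a polynomial [f_m] of degree
    exactly [m], and the last column extracts the coefficient of [f_(k-1)].  So a
    linear relation between the rows, restricted to [k] columns, is a polynomial
    [Q] of degree less than [k] in the basis [f_0, ..., f_(k-1)]: it either has
    [k] roots, or has [k-1] roots and degree less than [k-1].  Hence [Q = 0]. *)
Require Import Defs.
From mathcomp Require Import all_boot all_order all_algebra all_field.

Import GRing.Theory.
Local Open Scope ring_scope.

(** Only the last summand reaches the top degree, so its coefficient must vanish; induction removes
    the others. *)
Lemma graded_poly_sum_eq0 (R : idomainType) (P : nat -> {poly R}) (n : nat)
    (c : nat -> R) :
    (forall i, (i < n)%N -> size (P i) = i.+1) ->
    \sum_(i < n) c i *: P i = 0 ->
  forall i, (i < n)%N -> c i = 0.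
Proof.
elim: n => [//|n IH] szP sum0.
have szP' i (lt_in : (i < n)%N) : size (P i) = i.+1 by rewrite szP // ltnW.
have cn0 : c n = 0.
  have /eqP : (\sum_(i < n.+1) c i *: P i)`_n = 0 by rewrite sum0 coef0.
  rewrite big_ord_recr coefD coefZ coef_sum big1 /= => [|i _]; last first.
    by rewrite coefZ nth_default ?mulr0 // szP'.
  have <- : lead_coef (P n) = (P n)`_n by rewrite /lead_coef szP.
  rewrite add0r mulf_eq0 lead_coef_eq0 -size_poly_eq0 szP //.
  by rewrite orbF => /eqP.
move: sum0; rewrite big_ord_recr /= cn0 scale0r addr0 => sum0 i.
by rewrite ltnS leq_eqVlt => /predU1P[-> //|]; exact: IH.
Qed.

(** The selected columns form a square matrix, so a trivial left kernel makes it invertible and its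
    right kernel trivial too. *)
Lemma free_col_of_row_kernel0 (F : fieldType) (m n : nat) (A : 'M[F]_(m, n))
    (S : {set 'I_n}) (cardS : #|S| = m) :
    (forall u : 'rV[F]_m,
       (forall j, j \in S -> (u *m A) 0 j = 0) -> u = 0) ->
  free [seq col j A | j <- enum S].
Proof.
(* Replacing [m] by [#|S|] makes the submatrix [B] square by its very type. *)
move: A; case: m / cardS => A kerA.
pose B := colsub (enum_val : 'I_#|S| -> 'I_n) A.
have B_unit : B \in unitmx.
  rewrite -row_free_unit; apply/inj_row_free => u uB0; apply: kerA => j jS.
  have /rowP/(_ (enum_rank_in jS j)) := uB0.
  by rewrite mulmx_colsub !mxE enum_rankK_in.
have -> : [seq col j A | j <- enum S] = [tuple col i B | i < #|S|].
  apply/(@eq_from_nth _ 0) => [|i].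
    by rewrite size_map [RHS]size_tuple -cardE.
  rewrite size_map -cardE => lt_i; rewrite -/(nat_of_ord (Ordinal lt_i)).
  move: (Ordinal lt_i) => {lt_i}i.
  rewrite [RHS]nth_mktuple (nth_map (enum_val i)) -?cardE //.
  by apply/colP => r; rewrite !mxE [in RHS](enum_val_nth (enum_val i)).
apply/freeP => c sum0 i.
have Bc0 : B *m (\col_i c i) = 0.
  apply/colP => r; rewrite -sum0 mxE summxE; apply: eq_bigr => j _.
  by rewrite nth_mktuple !mxE mulrC.
have /colP/(_ i) : \col_i c i = 0 by rewrite -[LHS](mulKmx B_unit) Bc0 mulmx0.
by rewrite !mxE.
Qed.

Section PascalPoly.

Variables (p h : nat) (g : {poly 'F_p}) (gI : irreducible_poly g).
Hypotheses (p_pr : prime p) (sz_g : size g = h.+1).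

Local Notation sigma := (sigma h gI).

Definition pascal_poly (m : nat) : {poly Fq gI} :=
  \prod_(1 <= i < m.+1) ((sigma i)^-1 *: ('X - (sigma i.-1)%:P)).

Lemma horner_pascal_poly (m n : nat) :
  (pascal_poly m).[sigma n] = pascal_coef h gI m n.
Proof.
rewrite horner_prod; apply: eq_bigr => i _.
by rewrite hornerZ hornerXsubC mulrC.
Qed.

Lemma sigma_inj (m n : nat) :
  (m < p ^ h)%N -> (n < p ^ h)%N -> sigma m = sigma n -> m = n.
Proof.
move=> lt_m lt_n eq_mn.
by rewrite -(sum_sigma gI p_pr sz_g lt_m) eq_mn sum_sigma.
Qed.

(** All digits of 0 vanish, so [sigma 0 = 0], and injectivity leaves no other zero below [p ^ h]. *)
Lemma sigma_neq0 (n : nat) : (0 < n < p ^ h)%N -> sigma n != 0.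
Proof.
case/andP=> n_gt0 lt_n; apply: contraTneq n_gt0 => sn0.
rewrite -leqNgt leqn0; apply/eqP/sigma_inj; rewrite ?(leq_ltn_trans _ lt_n) //.
rewrite sn0 /Defs.sigma; set P := \poly_(i < h) _.
have -> : P = 0 by apply/polyP => i; rewrite coef_poly div0n mod0n coef0 if_same.
by rewrite raddf0.
Qed.

(** The bound on [m] keeps every scaling factor [(sigma i)^-1] nonzero, so the degree is the number
    of linear factors. *)
Lemma size_pascal_poly (m : nat) : (m < p ^ h)%N -> size (pascal_poly m) = m.+1.
Proof.
move=> lt_m; rewrite /pascal_poly scaler_prod size_scale.
  by rewrite size_prod_XsubC size_iota subn1.
rewrite prodf_seq_neq0; apply/allP=> i; rewrite mem_index_iota => /andP[i0 im].
by rewrite implyTb invr_eq0 sigma_neq0 // i0 (leq_ltn_trans _ lt_m).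
Qed.

End PascalPoly.

(** Separates the columns that are evaluations from the appended one. *)
Lemma card_ord_add1 (n : nat) (S : {set 'I_(n + 1)}) :
  #|S| = (#|[set i | lshift 1 i \in S]| + (rshift n ord0 \in S))%N.
Proof.
rewrite -!sum1_card big_mkcond big_split_ord /= big_ord1; congr addn.
by rewrite [RHS]big_mkcond; apply: eq_bigr => i _; rewrite inE.
Qed.

Theorem theorem1 (p h k : nat) (p_pr : prime p) (h_gt0 : (0 < h)%N)
    (g : {poly 'F_p}) (gI : irreducible_poly g) (sz_g : size g = h.+1)
    (k_gt0 : (0 < k)%N) (kq : (k <= p ^ h)%N)
    (S : {set 'I_(p ^ h + 1)}) (cardS : #|S| = k) :
  free [seq col j (supp_pascal_mx gI kq) | j <- enum S].
Proof.
apply: free_col_of_row_kernel0 (cardS) _ => u u0.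
case: k k_gt0 kq cardS u u0 => // k _ kq cardS u u0.
pose c (i : nat) : Fq gI := u 0 (inord i).
pose P := pascal_poly p h g gI.
pose Q := \sum_(i < k.+1) c i *: P i.
have szP i : (i < k.+1)%N -> size (P i) = i.+1.
  by move=> lt_i; apply: size_pascal_poly => //; exact: leq_trans (kq).
have szQn n : (n <= k.+1)%N -> (size (\sum_(i < n) c i *: P i)%R <= n)%N.
  move=> le_n; apply: (leq_trans (size_sum _ _ _)); apply/bigmax_leqP => i _.
  by rewrite (leq_trans (size_scale_leq _ _)) // szP // (leq_trans _ le_n).
pose A := [set i | lshift 1 i \in S].
have rootQ i : i \in A -> root Q (sigma h gI i).
  (* The entry of [u *m supp_pascal_mx gI kq] in column [i] is [Q] evaluated at [sigma i]. *)
  rewrite inE => /u0; rewrite mxE => uS; apply/eqP; rewrite -[RHS]uS.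
  rewrite horner_sum; apply: eq_bigr => j _.
  by rewrite row_mxEl !mxE hornerZ horner_pascal_poly /c inord_val.
have szQ : (size Q <= #|A|)%N.
  move: cardS; rewrite card_ord_add1 -/A.
  case: (boolP (rshift _ _ \in S)) => [last_S|_]; last first.
    by rewrite addn0 => ->; apply: szQn.
  rewrite addn1 => -[->].
  (* There are now [k.+1] rows, and the appended column is nonzero only in row [k], so its product
     with [u] is [c k]. *)
  have ck0 : c k = 0.
    have := u0 _ last_S; rewrite mxE big_ord_recr big1 /= => [|i _].
      rewrite row_mxEr mxE /= eqxx mulr1 add0r /c => <-; congr (u 0 _).
      by apply/val_inj; rewrite /= inordK.
    by rewrite row_mxEr mxE /= ltn_eqF // mulr0.
  by rewrite /Q big_ord_recr /= ck0 scale0r addr0 szQn.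
have Q0 : Q = 0.
  have [//|Q_neq0] := eqVneq Q 0.
  suff: (#|A| < size Q)%N by rewrite ltnNge szQ.
  (* Distinct indices in [A] give distinct roots, since [sigma] is injective; a nonzero [Q] has
     fewer roots than its size. *)
  rewrite cardE -(size_map (fun i : 'I_(p ^ h) => sigma h gI i)).
  apply: (max_poly_roots Q_neq0).
    by apply/allP => x /mapP[i]; rewrite mem_enum => /rootQ ri ->.
  by rewrite map_inj_uniq ?enum_uniq //; apply/bij_inj/sigma_bij.
apply/rowP => i; rewrite mxE -[i in u 0 i]inord_val.
exact: (graded_poly_sum_eq0 _ P k.+1 c szP Q0).
Qed.
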